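(* Let $r\geqslant 2$ and let $(S_1,S_2)$ be an Euler pair of order $r$. Then for every $n\geqslant 0$, $$q_r(S_1;n)\equiv \overline p_r(S_1;n)\pmod 2.$$
   Context: For a set $S$ of positive integers, $p(S;n)$ is the number of partitions of $n$ with all parts in $S$, and for $k\geqslant 2$, $q_k(S;n)$ is the number of partitions of $n$ with parts in $S$ in which each part occurs at most $k-1$ times. A pair $(S_1,S_2)$ of subsets of the positive integers is an Euler pair of order $r$ if $q_r(S_1;n)=p(S_2;n)$ for all $n\geqslant 0$. An overpartition of $n$ is a partition of $n$ in which the first occurrence of a part may be overlined. For an Euler pair $(S_1,S_2)$ of order $r$, $\overline p_r(S_1;n)$ denotes the number of overpartitions of $n$ with all parts in $S_1$ in which only parts belonging to $S_1\setminus S_2$ may be overlined. *)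

(* Defs.v *)
From mathcomp Require Import all_boot.
From mathcomp Require Import boolp classical_sets.

Set Implicit Arguments.
Unset Strict Implicit.
Unset Printing Implicit Defensive.

Local Open Scope classical_set_scope.

Definition is_partition (n : nat) (s : seq nat) : bool :=
  [&& sorted geq s, 0 \notin s & sumn s == n].

Lemma is_partition_bounds (n : nat) (s : seq nat) :
  is_partition n s -> size s <= n /\ all (fun x => x <= n) s.
Proof.
case/and3P=> _ s0 /eqP <-; elim: s s0 => [//|x s IH].
rewrite inE negb_or eq_sym -lt0n => /andP[x0 /IH[sz al]].
split; first by rewrite /= -add1n leq_add.
rewrite /= leq_addr /=; apply: sub_all al => y ys.
by rewrite (leq_trans ys) ?leq_addl.
Qed.

(* An entry (x, b) is an occurrence of the part x, overlined iff b; only the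
   first occurrence of a given part can be overlined. *)
Definition is_overpartition (n : nat) (t : seq (nat * bool)) : bool :=
  is_partition n (unzip1 t) &&
  [forall i : 'I_(size t), (nth (0, false) t i).2 ==>
     (index (nth (0, false) t i).1 (unzip1 t) == i)].

(* By is_partition_bounds, (over)partitions of n have at most n entries, with
   parts at most n, so the finite types n.-bseq _ below contain all of them. *)
Definition parts (n : nat) (s : n.-bseq 'I_n.+1) : seq nat :=
  [seq val x | x <- s].

Definition over_parts (n : nat) (t : n.-bseq ('I_n.+1 * bool)) :
    seq (nat * bool) :=
  [seq (val x.1, x.2) | x <- t].

Definition num_part (S : set nat) (n : nat) : nat :=
  #|[pred s : n.-bseq 'I_n.+1 | is_partition n (parts s)
       & all (fun x => x \in S) (parts s)]|.

Definition num_part_lt (k : nat) (S : set nat) (n : nat) : nat :=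
  #|[pred s : n.-bseq 'I_n.+1 | is_partition n (parts s)
       & all (fun x => x \in S) (parts s)
         && all (fun x => count_mem x (parts s) <= k.-1) (parts s)]|.

Definition euler_pair (r : nat) (S1 S2 : set nat) : Prop :=
  [/\ S1 `<=` [set m | 0 < m], S2 `<=` [set m | 0 < m]
    & forall n, num_part_lt r S1 n = num_part S2 n].

(* The order r of the Euler pair enters only through the choice of S2. *)
Definition num_overpart (S1 S2 : set nat) (n : nat) : nat :=
  #|[pred t : n.-bseq ('I_n.+1 * bool) | is_overpartition n (over_parts t)
       & all (fun x => x.1 \in S1) (over_parts t)
         && all (fun x => x.2 ==> (x.1 \in S1 `\` S2)) (over_parts t)]|.

(* Main.v *)
Require Import Defs.
From mathcomp Require Import all_boot.
From mathcomp Require Import boolp classical_sets.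
From mathcomp Require Import all_algebra.

Set Implicit Arguments.
Unset Strict Implicit.
Unset Printing Implicit Defensive.

Import GRing.Theory Num.Theory.

(** Toggling the overline on the first entry whose part is not in S2 is an
    involution on the overpartitions that have such a part, so modulo 2 only
    the partitions with parts in the intersection of S1 and S2 survive.
    It remains to see that S2 is contained in S1.  Multiplying the generating
    functions of the two sides of the Euler pair condition by
    prod_{S1} (1 - X^i) * prod_{S2} (1 - X^i) gives
      prod_{S2} (1 - X^i) * prod_{r S1} (1 - X^i) = prod_{S1} (1 - X^i),
    and the exponents of such products are unique, so that the indicator of S2
    plus that of r S1 is the indicator of S1.  The infinite products are
    replaced by integer polynomials compared up to degree N. *)

(** * Toggling one overline *)

Section Flip.
Variables (T : eqType) (a : pred T).
Implicit Types t : seq (T * bool).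

Fixpoint flip t :=
  if t is x :: t' then
    if a x.1 then (x.1, ~~ x.2) :: t' else x :: flip t'
  else [::].

Lemma flipK : involutive flip.
Proof.
elim=> [//|[x b] t IH] /=; case: ifP => /= ax; rewrite ax ?negbK //.
by rewrite IH.
Qed.

Lemma unzip1_flip t : unzip1 (flip t) = unzip1 t.
Proof. by elim: t => [//|[x b] t IH] /=; case: ifP => //= _; rewrite IH. Qed.

Lemma size_flip t : size (flip t) = size t.
Proof. by rewrite -(size_map fst) -/(unzip1 _) unzip1_flip size_map. Qed.

(** The index [find a (unzip1 t)] is the toggled position; if no part satisfies [a] it equals
    [size t], and nothing changes. *)
Lemma nth_flip x0 t i : i < size t ->
  nth x0 (flip t) i =
  ((nth x0 t i).1, (nth x0 t i).2 (+) (i == find a (unzip1 t))).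
Proof.
elim: t i => [//|[x b] t IH] [|i] /=; case: ifP => /= ax it.
- by rewrite addbT.
- by rewrite addbF.
- by rewrite addbF -surjective_pairing.
- by rewrite IH // eqSS.
Qed.

Lemma odd_count_flip t : has a (unzip1 t) ->
  odd (count snd (flip t)) = ~~ odd (count snd t).
Proof.
elim: t => [//|[x b] t IH] /=; case: ifP => /= [_ _|_ /IH h].
  by rewrite !oddD; case: b; case: (odd (count _ _)).
by rewrite !oddD h addbN.
Qed.

(** An earlier occurrence of the same value would also satisfy [a], and [find] would have stopped
    there. *)
Lemma index_nth_find x0 (s : seq T) :
  has a s -> index (nth x0 s (find a s)) s = find a s.
Proof.
elim: s => [//|x s IH] /=; case ax: (a x) => /= hs; first by rewrite eqxx.
rewrite IH //; case: eqP => // E.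
by rewrite E nth_find in ax.
Qed.
End Flip.

Lemma flip_map (T U : eqType) (f : T -> U) (a : pred U) (t : seq (T * bool)) :
  [seq (f x.1, x.2) | x <- flip (a \o f) t] =
  flip a [seq (f x.1, x.2) | x <- t].
Proof. by elim: t => [//|[x b] t IH] /=; case: ifP => //= _; rewrite IH. Qed.

Lemma is_overpartitionP n t :
  reflect (is_partition n (unzip1 t) /\
    forall i, i < size t -> (nth (0, false) t i).2 ->
      index (nth (0, false) t i).1 (unzip1 t) = i)
    (is_overpartition n t).
Proof.
apply: (iffP andP) => -[h1 h2]; split=> //.
  move=> i it b; move/forallP: h2 => /(_ (Ordinal it)) /implyP /= /(_ b).
  by move/eqP.
by apply/forallP=> i; apply/implyP=> /(h2 _ (ltn_ord i)) /eqP.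
Qed.

(* The first entry whose part satisfies [a] is the first occurrence of that
   part, so it may be overlined. *)
Lemma is_overpartition_flip n (a : pred nat) t :
  is_overpartition n t -> is_overpartition n (flip a t).
Proof.
move=> /is_overpartitionP[h1 h2]; apply/is_overpartitionP.
rewrite unzip1_flip; split=> // i; rewrite size_flip => it.
rewrite nth_flip //=; case: eqP => [E _|_]; last first.
  by rewrite addbF; exact: h2.
have ha : has a (unzip1 t) by rewrite has_find -E size_map.
by rewrite -(nth_map _ 0) // E index_nth_find.
Qed.

Lemma all_flip (a : pred nat) (P : pred (nat * bool)) t :
  (forall x b, a x -> P (x, b) -> P (x, ~~ b)) -> all P t -> all P (flip a t).
Proof.
move=> h; elim: t => [//|[x b] t IH] /= /andP[px pt].
case: ifP => /= ax; last by rewrite px IH.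
by rewrite h.
Qed.

(** [f] exchanges the elements of [A] satisfying [k] with the others, so the two classes have the
    same size. *)
Lemma even_card_involution (T : finType) (A : {set T}) (f : T -> T)
    (k : pred T) :
  involutive f -> {in A, forall x, f x \in A} ->
  {in A, forall x, k (f x) = ~~ k x} -> ~~ odd #|A|.
Proof.
move=> fK fA kf; rewrite -(cardsID [set x | k x] A).
suff -> : A :\: [set x | k x] = f @: (A :&: [set x | k x]).
  by rewrite card_imset ?addnn ?odd_double //; exact: inv_inj.
apply/setP => x; apply/idP/imsetP => [|[y]]; rewrite !inE.
  case/andP=> kx xA; exists (f x); last by rewrite fK.
  by rewrite !inE fA //= kf.
by case/andP=> yA ky ->; rewrite fA // kf // ky.
Qed.

(** * Transport to bounded sequences *)

Definition flip_bseq n (T : eqType) (a : pred T) (t : n.-bseq (T * bool)) :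
  n.-bseq (T * bool) := @Bseq n _ (flip a t)
    (etrans (congr1 (leq^~ n) (size_flip a t)) (size_bseq t)).

Lemma flip_bseqK n (T : eqType) (a : pred T) :
  involutive (@flip_bseq n T a).
Proof. by move=> t; apply: val_inj; rewrite /= flipK. Qed.

Lemma over_parts_flip n (a : pred nat) (t : n.-bseq ('I_n.+1 * bool)) :
  over_parts (flip_bseq (a \o val) t) = flip a (over_parts t).
Proof. exact: flip_map. Qed.

Lemma parts_inj n : injective (@parts n).
Proof. by move=> s t /(inj_map val_inj); exact: val_inj. Qed.

Lemma over_parts_inj n : injective (@over_parts n).
Proof.
move=> s t h; apply: val_inj; apply: inj_map h.
by move=> -[x b] [y c] /= [] /val_inj -> ->.
Qed.

Lemma parts_surj n s : is_partition n s -> exists b, @parts n b = s.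
Proof.
case/is_partition_bounds=> sz al.
have sz' : size [seq inord x : 'I_n.+1 | x <- s] <= n by rewrite size_map.
exists (Bseq sz'); rewrite /parts -map_comp; apply: map_id_in => x xs /=.
by rewrite inordK // ltnS (allP al).
Qed.

Definition plain_bseq n (T : Type) (s : n.-bseq T) : n.-bseq (T * bool) :=
  @Bseq n _ [seq (x, false) | x <- s]
    (etrans (congr1 (leq^~ n) (size_map (pair^~ false) s)) (size_bseq s)).

Lemma over_parts_plain n (s : n.-bseq 'I_n.+1) :
  over_parts (plain_bseq s) = [seq (x, false) | x <- parts s].
Proof. by rewrite /over_parts /parts -!map_comp. Qed.

Lemma unzip1_plain (s : seq nat) : unzip1 [seq (x, false) | x <- s] = s.
Proof. by rewrite /unzip1 -map_comp map_id. Qed.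

Lemma is_overpartition_plain n s :
  is_overpartition n [seq (x, false) | x <- s] = is_partition n s.
Proof.
rewrite /is_overpartition unzip1_plain andb_idr // => _.
apply/forallP=> i; rewrite (nth_map 0) //.
by have := ltn_ord i; rewrite [X in _ < X]size_map.
Qed.

(** * Counting overpartitions modulo 2 *)

Lemma num_overpart_mod2 (S1 S2 : set nat) n :
  num_overpart S1 S2 n = num_part (S1 `&` S2) n %[mod 2].
Proof.
pose a : pred nat := fun x => x \notin S2.
rewrite /num_overpart; set C := [pred t | _ & _].
rewrite -(cardID [pred t | has a (unzip1 (over_parts t))] C).
have ev : ~~ odd #|[predI C & [pred t | has a (unzip1 (over_parts t))]]|.
  rewrite -cardsE.
  (* The colour reversed by the toggle is the parity of the number of overlined entries. *)
  apply: (@even_card_involution _ _ (flip_bseq (a \o val))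
            (fun t => odd (count snd (over_parts t)))).
  - exact: flip_bseqK.
  - move=> t; rewrite !inE over_parts_flip unzip1_flip.
    case/andP=> /and3P[h1 h2 h3] ->; rewrite andbT is_overpartition_flip //=.
    (* The two conditions are treated together: a newly overlined part must be known to lie in [S1]
       as well as outside [S2]. *)
    rewrite -all_predI; apply: all_flip; last by rewrite all_predI h2 h3.
    move=> x b ax /= /andP[xS _]; rewrite xS /=; apply/implyP => _.
    by rewrite in_setD xS.
  - move=> t; rewrite !inE over_parts_flip => /andP[_ h].
    by rewrite odd_count_flip.
rewrite -[LHS]modnDml [X in X + _]modn2 (negbTE ev) add0n; congr (_ %% 2).
rewrite -cardsE /num_part -[RHS]cardsE.
rewrite -[RHS](card_imset _ (_ : injective (@plain_bseq n _))); last first.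
  by move=> s t [/inj_map h]; apply/val_inj/h => x y [].
apply: eq_card => t; apply/idP/imsetP => [|[s]]; rewrite !inE.
  case/andP=> h /and3P[h1 h2 h3].
  (* When every part lies in [S2], nothing may be overlined, so [t] is the plain copy of a
     partition. *)
  have al : all (fun x => (x.1 \in S1) && (x.1 \in S2) && ~~ x.2)
                (over_parts t).
    apply/allP=> x xt; rewrite (allP h2) //=.
    have xS : x.1 \in S2.
      apply: contraNT h => xS; apply/hasP; exists x.1 => //.
      exact: map_f.
    rewrite xS; have := allP h3 _ xt; case: x.2 => //=.
    by rewrite in_setD xS andbF.
  have E : over_parts t = [seq (x, false) | x <- unzip1 (over_parts t)].
    rewrite -map_comp; apply/esym/map_id_in => x /(allP al) /=.
    by case: x => x [] //=; rewrite andbF.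
  have [s sE] : exists s, @parts n s = unzip1 (over_parts t).
    by apply: parts_surj; case/andP: h1.
  exists s; last by apply: over_parts_inj; rewrite over_parts_plain sE.
  rewrite !inE sE; case/andP: h1 => -> _ /=.
  rewrite all_map; apply: sub_all al => x /= /andP[/andP[x1 x2] _].
  by rewrite in_setI x1.
case/andP=> h1 h2 ->; rewrite over_parts_plain is_overpartition_plain.
rewrite unzip1_plain h1 2!all_map /= -all_predC.
have sub (P : pred nat) :
    (forall x, x \in (S1 `&` S2)%classic -> P x) -> all P (parts s).
  by move=> h; apply: sub_all h2.
apply/and3P; split; apply: sub => x; rewrite in_setI /a /= => /andP[x1 x2] //.
by rewrite x2.
Qed.

(** * Polynomials modulo X^(N+1) *)

Definition eq_upto {R : nzRingType} (N : nat) (p q : {poly R}) : Prop :=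
  forall i, i <= N -> (p`_i = q`_i)%R.

Section Trunc.
Local Open Scope ring_scope.
Variable R : comNzRingType.
Implicit Types (p q : {poly R}) (d e : nat -> nat).

Lemma eq_upto_sym N p q : eq_upto N p q -> eq_upto N q p.
Proof. by move=> h i iN; rewrite h. Qed.

Lemma eq_upto_trans N p q s : eq_upto N p q -> eq_upto N q s -> eq_upto N p s.
Proof. by move=> h1 h2 i iN; rewrite h1 ?h2. Qed.

Lemma eq_uptoW M N p q : (M <= N)%N -> eq_upto N p q -> eq_upto M p q.
Proof. by move=> MN h i iM; rewrite h ?(leq_trans iM). Qed.

Lemma eq_uptoM N p1 p2 q1 q2 : eq_upto N p1 q1 -> eq_upto N p2 q2 ->
  eq_upto N (p1 * p2) (q1 * q2).
Proof.
move=> h1 h2 i iN; rewrite !coefM; apply: eq_bigr => j _.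
by rewrite h1 ?h2 // ?(leq_trans (leq_subr _ _)) // (leq_trans _ iN) // -ltnS.
Qed.

Lemma eq_upto_prod N (I : finType) (F G : I -> {poly R}) :
  (forall i, eq_upto N (F i) (G i)) -> eq_upto N (\prod_i F i) (\prod_i G i).
Proof.
move=> h; elim/big_rec2: _ => [//|i q p _ IH].
exact: eq_uptoM.
Qed.

Lemma eq_upto_subXn N m : (N < m)%N -> eq_upto N (1 - 'X^m : {poly R}) 1.
Proof.
move=> Nm i iN; rewrite coefB coefXn.
by rewrite (ltn_eqF (leq_ltn_trans iN Nm)) subr0.
Qed.

Lemma eq_upto_exp N p m : eq_upto N p 1 -> eq_upto N (p ^+ m) 1.
Proof.
by move=> h; elim: m => [//|m IH]; rewrite exprS -[1]mulr1; apply: eq_uptoM.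
Qed.

Lemma geometric_prod (x : {poly R}) m :
  (\sum_(j < m) x ^+ j) * (1 - x) = 1 - x ^+ m.
Proof.
by rewrite mulrC -[1 - x]opprB mulNr -subrX1 opprB.
Qed.

(** * Euler products and uniqueness of their exponents *)

Definition euler_prod N d : {poly R} := \prod_(i < N) (1 - 'X^(i.+1)) ^+ d i.+1.

Lemma euler_prodS N d :
  euler_prod N.+1 d = euler_prod N d * (1 - 'X^(N.+1)) ^+ d N.+1.
Proof. exact: big_ord_recr. Qed.

Lemma euler_prodD N d e :
  euler_prod N d * euler_prod N e = euler_prod N (fun i => d i + e i)%N.
Proof. by rewrite -big_split; apply: eq_bigr => i _; rewrite exprD. Qed.

Lemma coef0_euler_prod N d : (euler_prod N d)`_0 = 1.
Proof.
elim: N => [|N IH]; first by rewrite /euler_prod big_ord0 coef1.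
rewrite euler_prodS coef0M IH mul1r -horner_coef0 !hornerE.
by rewrite expr0n subr0 expr1n.
Qed.

(** Each factor 1 - X^(N+1) subtracts the constant coefficient, which is 1, from the coefficient of
    X^(N+1). *)
Lemma coef_euler_prod N d :
  (euler_prod N.+1 d)`_N.+1 = (euler_prod N d)`_N.+1 - (d N.+1)%:R.
Proof.
rewrite euler_prodS; elim: (d _) => [|m IH]; first by rewrite mulr1 subr0.
rewrite exprSr mulrA mulrBr mulr1 coefB IH coefMXn ltnn subnn coef0M.
rewrite coef0_euler_prod mul1r -horner_coef0 !hornerE expr0n subr0 expr1n.
by rewrite -natr1 opprD addrA.
Qed.
End Trunc.

(** Induction on [N]: the last factor is 1 up to degree N, so the lower exponents agree; the
    coefficient of X^(N+1) then determines the last exponent, since naturals embed in the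
    integers. *)
Lemma euler_prod_inj N (d e : nat -> nat) :
  eq_upto N (euler_prod int N d) (euler_prod int N e) ->
  forall i, 0 < i <= N -> d i = e i.
Proof.
elim: N => [_ [|i]//|N IH h].
have hN : forall d, eq_upto N (euler_prod int N.+1 d) (euler_prod int N d).
  move=> d'; rewrite euler_prodS -[X in eq_upto _ _ X]mulr1.
  by apply: eq_uptoM => //; apply/eq_upto_exp/eq_upto_subXn.
have de : forall i, 0 < i <= N -> d i = e i.
  apply: IH; apply: eq_upto_trans (hN e).
  apply: eq_upto_trans (eq_uptoW _ h) => //;   exact: eq_upto_sym.
move=> i /andP[i0]; rewrite leq_eqVlt => /predU1P[->|]; last first.
  by rewrite ltnS => iN; apply: de; rewrite i0.
have E : euler_prod int N d = euler_prod int N e.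
  by apply: eq_bigr => j _; rewrite de ?ltn_ord.
have := h N.+1 (leqnn _); rewrite !coef_euler_prod E => /addrI/oppr_inj/eqP.
by rewrite eqr_nat => /eqP.
Qed.

(** * Generating functions for bounded multiplicities *)

(** For positive [B], this agrees up to degree [N] with the generating function of partitions into
    parts from [S], each used fewer than [B] times. *)
Definition mult_gf (N B : nat) (S : set nat) : {poly int} :=
  (\prod_(i < N) (\sum_(j < B) ('X^(i.+1)) ^+ j) ^+ (i.+1 \in S))%R.

Lemma mult_gf_euler N B S :
  (mult_gf N B S * euler_prod int N (fun i => i \in S) =
   \prod_(i < N) (1 - 'X^(i.+1 * B)) ^+ (i.+1 \in S))%R.
Proof.
rewrite -big_split; apply: eq_bigr => i _.
by rewrite /= -exprMn geometric_prod exprM.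
Qed.

(** All the X^(iB) lie beyond degree [N], so the multiplicity bound is invisible there. *)
Lemma mult_gf_large N B S : N < B ->
  eq_upto N (mult_gf N B S * euler_prod int N (fun i => i \in S))%R 1%R.
Proof.
move=> NB; rewrite mult_gf_euler.
have E : (\prod_(i < N) 1 = 1 :> {poly int})%R by rewrite big1_eq.
rewrite -[X in eq_upto _ _ X]E.
apply: eq_upto_prod => i; apply/eq_upto_exp/eq_upto_subXn.
by rewrite (leq_trans NB) // leq_pmull.
Qed.

(** The exponent on the right is, for [k] between 1 and [N], the indicator of the set of multiples
    iB with i in [S]. *)
Lemma mult_gf_small N B S : 0 < B ->
  eq_upto N (mult_gf N B S * euler_prod int N (fun i => i \in S))%R
    (euler_prod int N (fun k => \sum_(i < N) (k == i.+1 * B) * (i.+1 \in S))).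
Proof.
move=> B0; rewrite mult_gf_euler.
have -> : (euler_prod int N
               (fun k => (\sum_(i < N) (k == i.+1 * B) * (i.+1 \in S))%N) =
    \prod_(i < N) (\prod_(k < N) (1 - 'X^(k.+1)) ^+ (k.+1 == i.+1 * B)%N)
                  ^+ (i.+1 \in S))%R.
  under [RHS]eq_bigr => i _ do rewrite -prodrXl.
  rewrite exchange_big; apply: eq_bigr => k _.
  by rewrite expr_sum; apply: eq_bigr => i _; rewrite exprM.
apply: eq_upto_prod => i; case: (_ \in S) => //; rewrite !expr1.
(* The product over [k] reduces to its factor at [k.+1 = i.+1 * B]; when this exceeds [N] there is
   none, and the left side is 1 up to degree [N]. *)
have [le|gt] := leqP (i.+1 * B) N.
  have lt : (i.+1 * B).-1 < N by rewrite prednK ?muln_gt0.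
  rewrite (bigD1 (Ordinal lt)) //= prednK ?muln_gt0 // eqxx expr1.
  rewrite big1 ?mulr1 // => k /eqP kn; case: eqP => // E; case: kn.
  by apply: val_inj => /=; rewrite -E.
rewrite big1; first exact: eq_upto_subXn.
by move=> k _; case: eqP => // E; move: (ltn_ord k); rewrite E leqNgt gt.
Qed.

Lemma mult_gf_sub r S1 S2 N : 0 < r ->
  eq_upto N (mult_gf N r S1) (mult_gf N N.+1 S2) ->
  forall i, 0 < i <= N -> i \in S2 -> i \in S1.
Proof.
move=> r0 h i iN iS2.
set F1 := euler_prod int N (fun i => i \in S1).
set F2 := euler_prod int N (fun i => i \in S2).
have E : eq_upto N F1 (euler_prod int N (fun k =>
  \sum_(i < N) (k == i.+1 * r) * (i.+1 \in S1) + (k \in S2))%N).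
  rewrite -euler_prodD.
  (* This product is evaluated twice: directly through [mult_gf_small], and, after replacing
     [mult_gf N r S1] by [mult_gf N N.+1 S2], as [F1]. *)
  apply: (@eq_upto_trans _ _ _ (mult_gf N r S1 * F1 * F2)%R); last first.
    by apply: eq_uptoM => //; apply: mult_gf_small.
  apply: eq_upto_sym; rewrite mulrAC -[X in eq_upto _ _ X]mul1r.
  apply: eq_uptoM => //.
  apply: (@eq_upto_trans _ _ _ (mult_gf N N.+1 S2 * F2)%R).
    exact: eq_uptoM.
  exact: mult_gf_large.
(* At [i] in [S2] the right-hand exponent is at least 1, so the indicator of [S1] cannot vanish. *)
by have := euler_prod_inj E iN; rewrite iS2 addn1; case: (i \in S1).
Qed.

(** * Partitions as multiplicity functions *)

Lemma sumn_count N s : all (fun x => 0 < x <= N) s ->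
  sumn s = \sum_(i < N) i.+1 * count_mem i.+1 s.
Proof.
elim: s => [|x s IH] /=.
  by rewrite big1 // => i _; rewrite muln0.
case/andP=> /andP[x0 xN] /IH ->.
under [RHS]eq_bigr => i _ do rewrite mulnDr.
rewrite [RHS]big_split /=; congr (_ + _).
have xlt : x.-1 < N by rewrite prednK.
rewrite (bigD1 (Ordinal xlt)) //= prednK // eqxx muln1 big1 ?addn0 // => i ni.
case: eqP => E; last by rewrite muln0.
by case/eqP: ni; apply: val_inj; rewrite /= E.
Qed.

Lemma is_partition_parts n s :
  is_partition n s -> all (fun x => 0 < x <= n) s.
Proof.
move=> h; have [_ /allP al] := is_partition_bounds h.
case/and3P: h => _ s0 _; apply/allP=> x xs; rewrite al // andbT lt0n.
by apply: contraNneq s0 => <-.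
Qed.

(** Inverse of taking multiplicities; the index [i] stands for the part [i.+1], which keeps 0
    out. *)
Definition of_mult N (f : 'I_N -> nat) : seq nat :=
  sort geq (flatten [seq nseq (f i) i.+1 | i <- enum 'I_N]).

Lemma count_of_mult N (f : 'I_N -> nat) (a : pred nat) :
  count a (of_mult f) = \sum_(i < N) a i.+1 * f i.
Proof.
rewrite count_sort count_flatten -map_comp sumnE big_map big_enum /=.
by apply: eq_bigr => i _; rewrite count_nseq.
Qed.

Lemma count_mem_of_mult N (f : 'I_N -> nat) i :
  count_mem i.+1 (of_mult f) = (if insub i is Some j then f j else 0).
Proof.
rewrite count_of_mult; case: insubP => [j _ <-|iN].
  rewrite (bigD1 j) //= eqxx mul1n big1 ?addn0 // => k kj.
  by rewrite /= eqSS val_eqE (negbTE kj).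
rewrite big1 // => k _ /=; case: eqP => // -[E].
by rewrite -E ltn_ord in iN.
Qed.

Lemma mem_of_mult N (f : 'I_N -> nat) (P : pred nat) :
  all P (of_mult f) = [forall i : 'I_N, P i.+1 || (f i == 0)].
Proof.
have -> : all P (of_mult f) = (count (predC P) (of_mult f) == 0).
  by rewrite -leqn0 leqNgt -has_count has_predC negbK.
rewrite count_of_mult sum_nat_eq0; apply: eq_forallb => i /=.
by rewrite muln_eq0 eqb0 negbK.
Qed.

Lemma of_mult_partition N (f : 'I_N -> nat) :
  is_partition (\sum_(i < N) i.+1 * f i) (of_mult f).
Proof.
apply/and3P; split.
- by apply: sort_sorted => x y; exact: leq_total.
- have : all (predC1 0) (of_mult f) by rewrite mem_of_mult; apply/forallP.
  by rewrite all_predC has_pred1.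
rewrite (@sumn_count N); last first.
  by rewrite mem_of_mult; apply/forallP=> i; rewrite ltn_ord.
apply/eqP/eq_bigr => i _; rewrite count_mem_of_mult; case: insubP => [j _ E|].
  by rewrite (val_inj E).
by rewrite ltn_ord.
Qed.

(** Both sequences are sorted, so it suffices that they are permutations of each other; [n <= N]
    ensures that every part is covered. *)
Lemma partition_eq_count N n s t : n <= N -> is_partition n s ->
  is_partition n t -> (forall i : 'I_N, count_mem i.+1 s = count_mem i.+1 t) ->
  s = t.
Proof.
move=> nN hs ht h.
have ps := is_partition_parts hs; have pt := is_partition_parts ht.
case/and3P: hs => ss _ _; case/and3P: ht => st _ _.
apply: (sorted_eq _ _ ss st).
- by move=> x y z h1 h2; exact: leq_trans h2 h1.
- by move=> x y; rewrite /= andbC => /anti_leq.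
apply/allP=> x; rewrite mem_cat => xst.
have /andP[x0 xn] : 0 < x <= n by case/orP: xst => [/(allP ps)|/(allP pt)].
have xlt : x.-1 < N by rewrite prednK // (leq_trans xn).
by have := h (Ordinal xlt); rewrite /= prednK // => ->.
Qed.

Lemma num_part_lt_mult N B S n : n <= N ->
  num_part_lt B.+1 S n =
  #|[pred f : {ffun 'I_N -> 'I_B.+1} |
      [forall i : 'I_N, (i.+1 \in S) || (f i == 0 :> nat)]
      & \sum_(i < N) i.+1 * f i == n]|.
Proof.
move=> nN; pose g (s : n.-bseq 'I_n.+1) : {ffun 'I_N -> 'I_B.+1} :=
  [ffun i : 'I_N => inord (count_mem i.+1 (parts s))].
rewrite /num_part_lt; set D := [pred s | _ & _].
(* [inord] does not truncate: a multiplicity is at most [B] if the part occurs, and 0 otherwise. *)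
have gE s : s \in D -> forall i, g s i = count_mem i.+1 (parts s) :> nat.
  case/and3P=> _ _ hB i; rewrite ffunE inordK // ltnS.
  have [|/count_memPn -> //] := boolP (i.+1 \in parts s).
  exact: (allP hB).
rewrite -[LHS](@card_in_imset _ _ g); last first.
  move=> s t hs ht E; apply: parts_inj.
  case/andP: (hs) => hsn _; case/andP: (ht) => htn _.
  by apply: (partition_eq_count nN hsn htn) => i; rewrite -!gE // E.
apply: eq_card => f; apply/imsetP/idP => [[s hs ->]|].
  case/and3P: (hs) => hsn hS _; apply/andP; split.
    apply/forallP=> i; rewrite gE //.
    have [/(allP hS) -> //|/count_memPn ->] := boolP (i.+1 \in parts s).
    by rewrite orbT.
  under eq_bigr => i _ do rewrite gE //.
  rewrite -sumn_count; first by case/and3P: hsn.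
  apply: sub_all (is_partition_parts hsn) => x /andP[-> xn].
  exact: leq_trans xn nN.
case/andP=> fS /eqP fn.
have hp := of_mult_partition (fun i : 'I_N => f i : nat); rewrite fn in hp.
have cf i : count_mem i.+1 (of_mult (fun j : 'I_N => f j : nat)) =
    if insub i is Some j then f j : nat else 0.
  exact: count_mem_of_mult.
have [s sE] := parts_surj hp.
have hs : s \in D.
  rewrite inE sE hp mem_of_mult fS /=; apply/allP=> -[|i] xs.
    by case/and3P: hp => _ /negP.
  by rewrite cf; case: insubP => // j _ _; rewrite -ltnS.
exists s => //; apply/ffunP => i; apply: val_inj; rewrite /= gE // sE cf.
by rewrite valK.
Qed.

(** * Coefficients of the generating functions *)

Lemma prod_nat_of_bool (I : finType) (b : I -> bool) :
  (\prod_i b i)%N = [forall i, b i].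
Proof.
case: forallP => [h|/forallP]; first by rewrite big1 // => i _; rewrite h.
by case/forallPn=> i /negbTE bi; rewrite (bigD1 i) //= bi.
Qed.

Lemma coef_mult_gf N B S n : n <= N ->
  ((mult_gf N B.+1 S)`_n = (num_part_lt B.+1 S n)%:R)%R.
Proof.
move=> nN.
(* If [i.+1] is outside [S], only the term [j = 0] survives. All factors thus become sums over the
   same index type, and expanding the product gives one monomial per multiplicity function. *)
pose G (i : 'I_N) (j : 'I_B.+1) : {poly int} :=
  (('X^(i.+1 * j)) *+ ((i.+1 \in S) || (j == 0 :> nat))%N)%R.
have -> : mult_gf N B.+1 S = (\prod_(i < N) \sum_(j < B.+1) G i j)%R.
  apply: eq_bigr => i _; rewrite /G; case: (_ \in S) => /=.
    by rewrite expr1; apply: eq_bigr => j _; rewrite mulr1n exprM.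
  by rewrite expr0 [RHS]big_ord_recl muln0 mulr1n big1 ?addr0.
rewrite bigA_distr_bigA /= coef_sum (num_part_lt_mult B S nN) -sum1_card.
rewrite natr_sum [RHS]big_mkcond; apply: eq_bigr => f _.
rewrite prodrMn prodrXr prod_nat_of_bool coefMn coefXn inE eq_sym.
by case: [forall _, _]; case: eqP.
Qed.

(** A partition of [n] has at most [n] entries, so no part can exceed the bound. *)
Lemma num_part_lt_large B S n : n < B -> num_part_lt B S n = num_part S n.
Proof.
move=> nB; apply: eq_card => s; rewrite !inE; congr (_ && _).
rewrite andb_idr // => _; apply/allP=> x _.
rewrite (leq_trans (count_size _ _)) // size_map (leq_trans (size_bseq s)) //.
by case: B nB.
Qed.

(** * Euler pairs and the congruence *)

(** To place a given [m] of [S2] in [S1], it is enough to truncate at degree [m]; the bound [m.+1]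
    used on the [S2] side restricts nothing there. *)
Lemma euler_pair_sub r S1 S2 :
  0 < r -> euler_pair r S1 S2 -> (S2 `<=` S1)%classic.
Proof.
case: r => [//|r] _ [_ pos h] m mS2; apply/set_mem; move/mem_set: (mS2).
apply: (@mult_gf_sub r.+1 S1 S2 m) => //; last first.
  by rewrite leqnn andbT; exact: pos.
by move=> i im; rewrite !coef_mult_gf // h num_part_lt_large.
Qed.

Theorem theorem3p7 (r : nat) (S1 S2 : set nat) (hr : 2 <= r)
    (hE : euler_pair r S1 S2) (n : nat) :
  num_part_lt r S1 n = num_overpart S1 S2 n %[mod 2].
Proof.
have sub := euler_pair_sub (ltnW hr) hE.
by rewrite num_overpart_mod2 (setIidr sub); case: hE => _ _ ->.
Qed.
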